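(* Let $q$ be a prime power, let $v, t$ be positive integers, and let $k>t$ be an integer. Let $\mathcal{P}$ be a non-trivial vector space $t$-partition of $\mathbb{F}_q^v$ such that $\mathcal{P}$ contains no element of dimension $i$ for any integer $i$ with $t<i<k$. Then the set $\mathcal{N}$ of all $t$-dimensional elements of $\mathcal{P}$ is $q^{k-t}$-divisible.
   Context: A vector space $t$-partition of $\mathbb{F}_q^v$ is a set $\mathcal{P}$ of subspaces of $\mathbb{F}_q^v$, all of dimension at least $t$, such that every $t$-dimensional subspace of $\mathbb{F}_q^v$ is contained in exactly one element of $\mathcal{P}$. It is called trivial if every element of $\mathcal{P}$ has dimension $t$ or $v$; otherwise it is non-trivial. A $t$-subspace is a $t$-dimensional subspace, and a hyperplane of $\mathbb{F}_q^v$ is a $(v-1)$-dimensional subspace. A set $\mathcal{C}$ of $t$-subspaces of $\mathbb{F}_q^v$ (possibly empty) is called $q^r$-divisible if $\#\mathcal{C}\equiv \#\{C\in\mathcal{C} : C\le H\}\pmod{q^r}$ for all hyperplanes $H$ of $\mathbb{F}_q^v$. *)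

(* Defs.v *)
From HB Require Import structures.
From mathcomp Require Import all_boot all_algebra.
Set Implicit Arguments.
Unset Strict Implicit.
Unset Printing Implicit Defensive.

(* VectorInternalTheory provides the subType structure of {vspace vT}.
   A subspace is encoded by its unique canonical generating matrix, so there
   are finitely many of them over a finite field. *)
Import VectorInternalTheory.

HB.instance Definition _ (F : finFieldType) (vT : vectType F) :=
  [Countable of {vspace vT} by <:].
HB.instance Definition _ (F : finFieldType) (vT : vectType F) :=
  [Finite of {vspace vT} by <:].

Definition vs_partition (F : finFieldType) (v t : nat)
    (P : {set {vspace 'rV[F]_v}}) : Prop :=
  (forall U, U \in P -> t <= \dim U) /\
  (forall T : {vspace 'rV[F]_v}, \dim T = t ->
     exists! U, U \in P /\ (T <= U)%VS).

Definition vs_trivial (F : finFieldType) (v t : nat)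
    (P : {set {vspace 'rV[F]_v}}) : Prop :=
  forall U, U \in P -> \dim U = t \/ \dim U = v.

Definition hyperplane (F : finFieldType) (v : nat)
    (H : {vspace 'rV[F]_v}) : Prop :=
  (\dim H).+1 = v.

(* With q = #|F|, this is q^r-divisibility; it is meant for sets C all of whose
   elements have the same dimension. *)
Definition qdivisible (F : finFieldType) (v r : nat)
    (C : {set {vspace 'rV[F]_v}}) : Prop :=
  forall H : {vspace 'rV[F]_v}, hyperplane H ->
    #|C| = #|[set U in C | (U <= H)%VS]| %[mod #|F| ^ r].

(* Main.v *)
(** Count the t-subspaces off a hyperplane H. There are
    q^(n-t) [n-1, t-1]_q of them inside an n-subspace U off H, which is 1 if
    n = t and a multiple of q^(k-t) if n >= k. The t-subspaces of the whole
    space off H are shared out among the elements of P; the total is a multiple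
    of q^(k-t), as is the share of each element of dimension at least k, so the
    number of t-dimensional elements of P off H is one too. *)
Require Import Defs.
From mathcomp Require Import all_boot all_algebra all_field zify.

Lemma dim_cap_hyperplane (F : finFieldType) (v : nat)
    (H U : {vspace 'rV[F]_v}) :
  hyperplane H -> ~~ (U <= H)%VS -> (\dim (U :&: H)).+1 = \dim U.
Proof.
rewrite /hyperplane => hypH nUH.
have := dimv_sum_cap U H.
have : \dim (U + H) <= v.
  by have := dimvS (subvf (U + H)%VS); rewrite dimvf /dim /= mul1n.
have : \dim H < \dim (U + H).
  rewrite (ltn_leqif (dimv_leqif_sup (addvSr U H))).
  by rewrite subv_add subvv andbT.
lia.
Qed.

Lemma card_setD_hyperplane (F : finFieldType) (v : nat)
    (H U : {vspace 'rV[F]_v}) :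
  hyperplane H -> ~~ (U <= H)%VS ->
  #|[set x in U | x \notin H]| = #|F| ^ (\dim U).-1 * #|F|.-1.
Proof.
move=> hypH nUH; have dUH := dim_cap_hyperplane F v H U hypH nUH.
have cardE (W : {vspace 'rV[F]_v}) : #|W| = #|F| ^ \dim W.
  exact: card_vspace.
have := cardsID [set x in H] [set x in U].
have -> : [set x in U] :&: [set x in H] = [set x in (U :&: H)%VS].
  by apply/setP=> x; rewrite !inE memv_cap.
have -> : [set x in U] :\: [set x in H] = [set x in U | x \notin H].
  by apply/setP=> x; rewrite !inE andbC.
rewrite !cardsE !cardE -dUH /= expnS => cardD.
have F_gt1 : 1 < #|F| := finNzRing_gt1 F.
nia.
Qed.

(** Cutting [T] with [H] and adding the line [<[x]>] to [S] are mutually inverse: a subspace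
    containing [x] is not inside [H], so the cut lowers its dimension by exactly one. *)
Lemma card_subspaces_through (F : finFieldType) (v t : nat)
    (H U : {vspace 'rV[F]_v}) (x : 'rV[F]_v) :
  hyperplane H -> x \in U -> x \notin H ->
  #|[set T : {vspace 'rV[F]_v} | (T <= U)%VS & (\dim T == t.+1) && (x \in T)]|
  = #|[set S : {vspace 'rV[F]_v} | (S <= U :&: H)%VS & \dim S == t]|.
Proof.
move=> hypH xU xH.
have capK (S : {vspace 'rV[F]_v}) : (S <= H)%VS -> ((S + <[x]>) :&: H)%VS = S.
  move=> SH; apply/eqP; rewrite eq_sym eqEdim subv_cap addvSl SH /=.
  have nSx : ~~ (S + <[x]> <= H)%VS.
    by rewrite subv_add -memvE (negPf xH) andbF.
  have := dim_cap_hyperplane F v H _ hypH nSx.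
  have := dimv_add_leqif S <[x]>; case=> + _.
  rewrite dim_vline; lia.
have capT (T : {vspace 'rV[F]_v}) : x \in T -> (\dim (T :&: H)).+1 = \dim T.
  move=> xT; apply: dim_cap_hyperplane => //.
  by apply: contra xH => /subvP; apply.
have addK (T : {vspace 'rV[F]_v}) : x \in T -> ((T :&: H) + <[x]>)%VS = T.
  move=> xT; apply/eqP; rewrite eqEdim subv_add capvSl -memvE xT /=.
  have xTH : x \in (T :&: H + <[x]>)%VS.
    by rewrite memvE addvSr.
  (* Both dimensions exceed that of [T :&: H] by one, since by [capK] the two subspaces meet [H] in
     the same subspace. *)
  rewrite -capT // -(capT _ xTH) capK ?capvSr //.
symmetry; rewrite -(card_in_imset (f := fun S => (S + <[x]>)%VS)).
  apply: eq_card => T; rewrite !inE; apply/imsetP/idP.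
    case=> S; rewrite inE subv_cap => /andP[/andP[SU SH] /eqP dS] ->.
    have xS : x \in (S + <[x]>)%VS by rewrite memvE addvSr.
    by rewrite xS subv_add SU -memvE xU /= -capT // capK // dS eqxx.
  case/and3P=> TU /eqP dT xT; exists (T :&: H)%VS; last by rewrite addK.
  by rewrite inE capvS //= -eqSS capT // dT.
move=> S1 S2; rewrite !inE !subv_cap => /andP[/andP[_ S1H] _].
by move=> /andP[/andP[_ S2H] _] eqS; rewrite -(capK S1) // eqS capK.
Qed.

(** The second factor is a Gaussian binomial coefficient, left unevaluated because the divisibility
    is read off the power of [#|F|] in front of it. *)
Lemma card_off_hyperplane (F : finFieldType) (v t : nat)
    (H U : {vspace 'rV[F]_v}) :
  hyperplane H -> ~~ (U <= H)%VS -> t < \dim U ->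
  #|[set T : {vspace 'rV[F]_v} | \dim T == t.+1 & (T <= U)%VS && ~~ (T <= H)%VS]|
  = #|F| ^ (\dim U - t.+1)
    * #|[set S : {vspace 'rV[F]_v} | (S <= U :&: H)%VS & \dim S == t]|.
Proof.
move=> hypH nUH lt_tU.
set A := [set T | _]; set B := [set S | _].
have F_gt1 : 1 < #|F| := finNzRing_gt1 F.
(* Count the pairs (T, x) with T in A and x in T off H. *)
have eq_pairs : #|A| * (#|F| ^ t * #|F|.-1) = #|F| ^ (\dim U).-1 * #|F|.-1 * #|B|.
  rewrite -(card_setD_hyperplane _ _ H U) // -!sum_nat_const.
  transitivity (\sum_(T in A) \sum_(x in [set x in U | x \notin H] | x \in T) 1).
    apply: eq_bigr => T; rewrite inE => /and3P[/eqP dT TU nTH].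
    rewrite -[X in _ ^ X]/(t.+1.-1) -dT -(card_setD_hyperplane _ _ H T) //.
    rewrite -sum1_card; apply: eq_bigl => x; rewrite !inE.
    case: (boolP (x \in T)) => xT; rewrite ?andbF ?andbT //=.
    by rewrite (subvP TU).
  rewrite (exchange_big_dep (fun x => x \in [set x in U | x \notin H])) /=; last first.
    by move=> T x _ /andP[].
  apply: eq_bigr => x xUH; have := xUH; rewrite inE => /andP[xU xH].
  rewrite /B -(card_subspaces_through _ _ _ _ _ x) // sum1dep_card.
  apply: eq_card => T; rewrite !inE xU xH /=.
  case: (boolP (x \in T)) => xT; rewrite ?andbF ?andbT //=.
  (* A point of [T] off [H] already keeps [T] from lying in [H], so this condition drops out of the
     count. *)
  have nTH : ~~ (T <= H)%VS by apply: contra xH => /subvP; apply.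
  by rewrite nTH andbT andbC.
have := eq_pairs.
have -> : (\dim U).-1 = t + (\dim U - t.+1) by lia.
rewrite expnD.
have q1 : 0 < #|F| ^ t * #|F|.-1 by rewrite muln_gt0 expn_gt0 -subn1 subn_gt0 F_gt1 (ltnW F_gt1).
move=> eqAB; apply/eqP; rewrite -(eqn_pmul2r q1) eqAB.
by rewrite [eqbRHS]mulnC mulnACA mulnA.
Qed.

Theorem proposition4p2 (F : finFieldType) (v t k : nat)
    (v_gt0 : 0 < v) (t_gt0 : 0 < t) (lt_tk : t < k)
    (P : {set {vspace 'rV[F]_v}})
    (partP : vs_partition t P) (ntrivP : ~ vs_trivial t P)
    (gapP : forall U, U \in P -> ~ (t < \dim U < k)) :
  qdivisible (k - t) [set U in P | \dim U == t].
Proof.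
case: partP => geP uniqP H hypH.
(* From here on the dimension [t] of the statement is written [t.+1], as in the counting lemmas. *)
case: t t_gt0 lt_tk ntrivP gapP geP uniqP => // t _ lt_tk ntrivP gapP geP uniqP.
set N := [set U in P | _]; set q := #|F|.
pose off (U : {vspace 'rV[F]_v}) :=
  #|[set T : {vspace 'rV[F]_v} | \dim T == t.+1 & (T <= U)%VS && ~~ (T <= H)%VS]|.
(* If [k] exceeded [v], the gap would leave only dimension [t.+1], making [P] trivial. The bound
   lets [off_big] apply to the whole space. *)
have le_kv : k <= v.
  rewrite leqNgt; apply/negP => lt_vk; apply: ntrivP => U PU; left.
  have leUv : \dim U <= v.
    by have := dimvS (subvf U); rewrite dimvf /dim /= mul1n.
  have := geP U PU; have := gapP U PU; lia.
have off_big (U : {vspace 'rV[F]_v}) : k <= \dim U -> q ^ (k - t.+1) %| off U.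
  move=> kU; case: (boolP (U <= H)%VS) => UH.
    rewrite /off (_ : [set _ | _] = set0) ?cards0 ?dvdn0 //.
    apply/setP=> T; rewrite !inE; apply/and3P=> -[_ TU /negP[]].
    exact: subv_trans TU UH.
  rewrite /off card_off_hyperplane //; last exact: leq_trans (ltnW lt_tk) kU.
  by rewrite dvdn_mulr // dvdn_exp2l // leq_sub2r.
(* A subspace of [U] of the same dimension is [U] itself, so the count is 0 or 1, a boolean read as
   a number. *)
have off_N U : U \in N -> off U = ~~ (U <= H)%VS.
  rewrite inE => /andP[_ /eqP dU]; rewrite /off.
  case: (boolP (U <= H)%VS) => UH.
    apply/eqP; rewrite cards_eq0; apply/eqP/setP=> T; rewrite !inE.
    apply/and3P=> -[_ TU /negP[]]; exact: subv_trans TU UH.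
  apply/eqP/cards1P; exists U; apply/setP=> T; rewrite !inE.
  apply/and3P/eqP => [[/eqP dT TU _]|->]; last by rewrite dU subvv.
  by apply/eqP; rewrite eqEdim TU dT dU /=.
have sum_off : off fullv = \sum_(U in P) off U.
  rewrite /off -sum1dep_card.
  transitivity (\sum_(T : {vspace 'rV[F]_v} | [&& \dim T == t.+1, (T <= fullv)%VS
      & ~~ (T <= H)%VS]) \sum_(U in P | (T <= U)%VS) 1).
    (* The inner sum is 1: exactly one element of [P] contains [T]. *)
    apply: eq_bigr => T /and3P[/eqP dT _ _].
    have [U [[PU TU] uniqU]] := uniqP T dT.
    rewrite (big_pred1 U) // => W; apply/andP/eqP => [[PW TW]|-> //].
    by rewrite (uniqU W).
  rewrite (exchange_big_dep (mem P)) /=; last by move=> T U _ /andP[].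
  apply: eq_bigr => U PU; rewrite -sum1dep_card; apply: eq_bigl => T.
  by rewrite subvf PU /= andbAC -andbA.
have sumN : \sum_(U in N) off U + #|[set U in N | (U <= H)%VS]| = #|N|.
  rewrite (eq_bigr _ off_N) -[RHS]sum1_card -sum1dep_card big_mkcondr /=.
  rewrite -big_split /=.
  by apply: eq_bigr => U _; case: (U <= H)%VS.
have dvdN : q ^ (k - t.+1) %| \sum_(U in N) off U.
  have := off_big fullv; rewrite dimvf /dim /= mul1n => /(_ le_kv).
  rewrite sum_off (bigID (fun U : {vspace 'rV[F]_v} => \dim U == t.+1)) /=.
  rewrite dvdn_addl; last first.
    apply: dvdn_sum => U /andP[PU ntU]; apply: off_big.
    have := geP U PU; have := gapP U PU; lia.
  by congr (_ %| _); apply: eq_bigl => U; rewrite inE.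
by rewrite -sumN -modnDml (eqP dvdN) add0n.
Qed.
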